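(* Let $r=\log_2(8/7)$, $a=\frac4r$ and $\beta=\frac2r$. Then asymptotically almost surely $$\vec{\chi}_a(\mathcal{T}_n)\geq n-a\log_2 n+\beta\log_2\log_2 n-O(1);$$ that is, there is an absolute constant $C$ such that the probability that $\vec{\chi}_a(\mathcal{T}_n)\geq n-a\log_2 n+\beta\log_2\log_2 n-C$ tends to $1$ as $n\to\infty$.
   Context: A tournament is a finite nonempty digraph without loops in which exactly one of $uv$, $vu$ is an arc for every pair of distinct vertices $u,v$. $\mathcal{T}_n$ is the uniform random tournament on $n$ labelled vertices: every edge of $K_n$ is oriented independently, with both directions equally likely. A digraph is acyclic if it has no directed cycle. For disjoint $X,Y\subseteq V(D)$, $D[X,Y]$ is the bipartite subdigraph on $X\cup Y$ whose arcs are all arcs of $D$ with one end in $X$ and the other in $Y$. An acyclic $q$-dicolouring of an oriented graph $D$ (a digraph with no loops, parallel arcs, or opposite arcs) is a partition of $V(D)$ into nonempty classes $C_1,\ldots,C_q$ such that every induced subdigraph $D[C_i]$ is acyclic and every $D[C_i,C_j]$ with $i\neq j$ is acyclic. The acyclic dichromatic number $\vec{\chi}_a(D)$ is the minimum such $q$. *)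

(* Defs.v *)
From mathcomp Require Import all_boot all_order all_algebra.
From mathcomp Require Import reals exp.

Set Implicit Arguments.
Unset Strict Implicit.
Unset Printing Implicit Defensive.

Import Order.TTheory GRing.Theory Num.Theory.

(* A digraph without parallel arcs on the finite vertex type V is represented
   by its arc set D : {set V * V}.  A subdigraph is again an arc set over V:
   the vertices left out become isolated, which affects no directed cycle. *)

Section Digraphs.

Variable V : finType.
Implicit Types (D : {set V * V}) (X Y C : {set V}) (P : {set {set V}}).

Definition arc D : rel V := [rel u v | (u, v) \in D].

(* The bound on k loses nothing, as the vertices of a directed cycle are
   pairwise distinct; see acyclicP. *)
Definition acyclic D : bool :=
  [forall k : 'I_#|V|, forall c : k.+1.-tuple V, ~~ ucycleb (arc D) c].

Definition induced D X : {set V * V} := D :&: setX X X.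

Definition between D X Y : {set V * V} := D :&: (setX X Y :|: setX Y X).

(* The case u = v excludes loops. *)
Definition oriented D : bool :=
  [forall u, forall v, ~~ (((u, v) \in D) && ((v, u) \in D))].

Definition tournament D : bool :=
  [&& 0 < #|V|,
      [forall u, (u, u) \notin D]
    & [forall u, forall v, (u != v) ==> ((u, v) \in D) (+) ((v, u) \in D)]].

Definition acyclic_dicolouring D P : bool :=
  [&& partition P [set: V],
      [forall C in P, acyclic (induced D C)]
    & [forall X in P, forall Y in P, (X != Y) ==> acyclic (between D X Y)]].

Definition singletons : {set {set V}} := [set [set v] | v : V].

(* For oriented D the partition into singletons is an acyclic dicolouring, so
   that this is a genuine minimum; see acyclic_dichromatic_numberP. *)
Definition acyclic_dichromatic_number D : nat :=
  #|[arg min_(P < singletons | acyclic_dicolouring D P) #|P|]|.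

Lemma acyclicP D :
  reflect (forall c : seq V, ucycle (arc D) c -> c = [::]) (acyclic D).
Proof.
apply: (iffP forallP) => [acD c cc | acD k].
  case: c cc => [//|x p] cc.
  have szp : size p < #|V|.
    by have := max_card (mem (x :: p)); rewrite (card_uniqP (ucycle_uniq cc)).
  have /forallP/(_ (in_tuple (x :: p))) := acD (Ordinal szp).
  by rewrite /ucycleb; move: cc; rewrite /ucycle => ->.
apply/forallP => c; apply/negP => cc.
by have := congr1 size (acD c cc); rewrite size_tuple.
Qed.

Lemma singletons_acyclic_dicolouring D :
  oriented D -> acyclic_dicolouring D singletons.
Proof.
move=> /forallP oD.
have two_arcs (E : {set V * V}) : (forall x y z, ~~ (arc E x y && arc E y z)) ->
    acyclic E.
  move=> noE; apply/acyclicP => -[//|x p] /ucycle_cycle /=.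
  case: p => [|y p] /=; first by rewrite andbT => exx; have := noE x x x; rewrite exx.
  by case: p => [|z p] /= /and3P[exy eyz _];
    [have := noE x y x | have := noE x y z]; rewrite exy eyz.
have D_irr u : (u, u) \notin D by have /forallP/(_ u) := oD u; rewrite andbb.
apply/and3P; split.
- apply/and3P; split.
  + rewrite /cover eqEsubset subsetT /=; apply/subsetP => v _.
    by apply/bigcupP; exists [set v]; rewrite ?set11 //; apply/imsetP; exists v.
  + apply/trivIsetP => _ _ /imsetP[u _ ->] /imsetP[v _ ->] uv.
    by rewrite disjoints1 inE; apply: contraNN uv => /eqP ->.
  + by apply/imsetP => -[v _] /setP/(_ v); rewrite !inE eqxx.
- apply/forall_inP => _ /imsetP[v _ ->]; apply: two_arcs => x y z.
  apply/negP; rewrite /arc /= !inE /= => /andP[/andP[xyD /andP[/eqP xv /eqP yv]] _].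
  by move: xyD; rewrite xv yv (negPf (D_irr v)).
- apply/forall_inP => _ /imsetP[u _ ->]; apply/forall_inP => _ /imsetP[v _ ->].
  apply/implyP => _; apply: two_arcs => x y z; apply/negP.
  rewrite /arc /= !inE /= => /andP[/andP[xyD xy] /andP[yzD yz]].
  have /forallP/(_ v) := oD u.
  case/orP: xy xyD => /andP[/eqP -> /eqP yE] Dxy; move: yz yzD; rewrite yE in Dxy *.
    case/orP => /andP[/eqP a /eqP ->] Dyz; first by rewrite (negPf (D_irr v)) in Dyz.
    by rewrite Dxy Dyz.
  case/orP => /andP[/eqP a /eqP ->] Dyz; last by rewrite (negPf (D_irr u)) in Dyz.
  by rewrite Dxy Dyz.
Qed.

Lemma acyclic_dichromatic_numberP D : oriented D ->
  (exists2 P, acyclic_dicolouring D P & #|P| = acyclic_dichromatic_number D) /\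
  (forall P, acyclic_dicolouring D P -> acyclic_dichromatic_number D <= #|P|).
Proof.
move=> oD; rewrite /acyclic_dichromatic_number.
case: arg_minnP => [|P dP minP]; first exact: singletons_acyclic_dicolouring.
by split=> //; exists P.
Qed.

Lemma tournament_oriented D : tournament D -> oriented D.
Proof.
case/and3P => _ /forallP irr /forallP tot.
apply/forallP => u; apply/forallP => v; apply/negP => /andP[uv vu].
have [euv|nuv] := eqVneq u v; first by rewrite euv (negPf (irr v)) in uv.
by have /forallP/(_ v) := tot u; rewrite nuv uv vu.
Qed.

End Digraphs.

Definition tournaments (n : nat) : {set {set 'I_n * 'I_n}} :=
  [set D | tournament D].

Lemma tournaments_gt0 n : 0 < n -> 0 < #|tournaments n|.
Proof.
move=> n_gt0; apply/card_gt0P; exists [set a : 'I_n * 'I_n | a.1 < a.2].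
rewrite inE; apply/and3P; split; first by rewrite card_ord.
  by apply/forallP => u; rewrite inE /= ltnn.
apply/forallP => u; apply/forallP => v; apply/implyP => uv; rewrite !inE /=.
by case: ltngtP => // /val_inj euv; rewrite euv eqxx in uv.
Qed.

Local Open Scope ring_scope.

(* The uniform law on the tournaments with vertex set 'I_n, which is also the
   law obtained by orienting the edges of K_n by independent fair coins. *)
Definition Pr_tournament (R : realType) (n : nat)
    (A : pred {set 'I_n * 'I_n}) : R :=
  #|[set D in tournaments n | A D]|%:R / #|tournaments n|%:R.

Definition log2 (R : realType) (x : R) : R := ln x / ln 2.

(* Main.v *)
Require Import Defs.
From mathcomp Require Import all_boot all_order all_algebra reals.
From mathcomp Require Import ring lra zify.

Set Implicit Arguments.
Unset Strict Implicit.
Unset Printing Implicit Defensive.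

Import Order.TTheory GRing.Theory Num.Theory.

(* Pick a representative in each class of an acyclic dicolouring with q classes.
   The k = n - q pairs (representative, other vertex of its class) determine the
   partition, so that at most C(n^2, k) partitions have defect k.

   For a fixed partition with class sizes c_i, an acyclic class is a transitive
   tournament (probability c! / 2^C(c,2)) and an acyclic pair of classes x, y has
   no directed 4-cycle, which has probability at most (7/8)^((x-1)(y-1)); here
   7/8 is the exact value for x = y = 2.  Independence of the blocks and
   C(k,2) = sum_i C(c_i - 1, 2) + sum_(i<j) (c_i - 1)(c_j - 1) bound the
   probability that the partition is a dicolouring by (7/8)^C(k,2).  Hence
   partitions of defect k contribute at most C(n^2, k) (7/8)^C(k,2) to the union
   bound, which is at most n^-2 as soon as
   k > a log2 n - beta log2 log2 n + C, and there are only n + 1 values of k. *)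

Lemma leq_card_bigcup (I T : finType) (P : pred I) (F : I -> {set T}) :
  #|\bigcup_(i | P i) F i| <= \sum_(i | P i) #|F i|.
Proof.
elim/big_rec2: _ => [|i m A _ leAm]; first by rewrite cards0.
by rewrite (leq_trans (leq_card_setU _ _)) ?leq_add2l.
Qed.

(** * Bipartite orientations without directed 4-cycles *)

Section Nested.

Variables T1 T2 : finType.
Implicit Types (X M : {set T1}) (Y : {set T2}) (A : {set T1 * T2}).

(* Read as the set of arcs from X to Y in an orientation of the complete
   bipartite graph on X and Y, A is nested iff there is no directed 4-cycle. *)
Definition nested A : bool :=
  [forall x, forall x', forall y, forall y',
    ((x, y) \in A) && ((x', y') \in A) ==> ((x, y') \in A) || ((x', y) \in A)].

Lemma nestedP A :
  reflect (forall x x' y y', (x, y) \in A -> (x', y') \in A ->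
             (x, y') \in A \/ (x', y) \in A) (nested A).
Proof.
apply: (iffP idP) => [/forallP nA x x' y y' xy x'y'|nA].
  move/forallP/(_ x')/forallP/(_ y)/forallP/(_ y')/implyP: (nA x).
  by rewrite xy x'y' => /(_ isT)/orP.
do 4!apply/forallP => ?.
by apply/implyP => /andP[? ?]; apply/orP/nA.
Qed.

Definition nested_sets X Y : {set {set T1 * T2}} :=
  [set A in powerset (setX X Y) | nested A].

Lemma nestedI A X Y : nested A -> nested (A :&: setX X Y).
Proof.
move=> /nestedP nA; apply/nestedP => x x' y y'; rewrite !inE /=.
move=> /andP[xy /andP[-> ->]] /andP[x'y' /andP[-> ->]].
by rewrite !andbT; exact: nA.
Qed.

(** [M] merged into one vertex, represented by the element that [pick] selects; [expand] makes the
    same choice. *)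
Definition contract X M : {set T1} :=
  [set x in X | (x \notin M) || ([pick z in M] == Some x)].

Lemma card_contract X M : M \subset X -> M != set0 ->
  #|contract X M| = (#|X| - #|M|).+1.
Proof.
move=> sMX /set0Pn[z zM].
have [x0 px0 x0M] : exists2 x0, [pick z in M] = Some x0 & x0 \in M.
  by case: pickP => [x0 x0M|/(_ z)]; [exists x0 | rewrite zM].
have -> : contract X M = x0 |: (X :\: M).
  apply/setP => x; rewrite !inE px0 -[Some x0 == _]/(x0 == x) [x0 == x]eq_sym.
  have [->|nx] := eqVneq x x0; first by rewrite x0M /= (subsetP sMX).
  by rewrite orbF andbC.
by rewrite cardsU1 !inE x0M /= cardsD (setIidPr sMX).
Qed.

Definition fiber A (x : T1) : {set T2} := [set y | (x, y) \in A].

(** Recovers a nested set from what remains once [M] is merged and [y0] deleted; [set0] is a default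
    for empty [M]. *)
Definition expand (y0 : T2) M A : {set T1 * T2} :=
  if [pick z in M] is Some x0 then
    [set p | if p.2 == y0 then
               (p.1 \in M) || (fiber A x0 \proper fiber A p.1)
             else (if p.1 \in M then x0 else p.1, p.2) \in A]
  else set0.

(* The neighbourhoods of the vertices of X form a chain.  Take those containing
   y0 and among them the minimal ones, which coincide: their owners form M and
   can be merged into one vertex.  A vertex outside M is then adjacent to y0
   iff its neighbourhood strictly contains the one of M, so y0 can be deleted
   without loss of information. *)
Lemma card_nested_sets_rec X Y y0 : y0 \notin Y ->
  #|nested_sets X (y0 |: Y)| <= #|nested_sets X Y| +
    \sum_(M in powerset X | M != set0) #|nested_sets (contract X M) Y|.
Proof.
move=> y0Y.
have sub : nested_sets X (y0 |: Y) \subset nested_sets X Y :|: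
    \bigcup_(M in powerset X | M != set0)
      expand y0 M @: nested_sets (contract X M) Y.
  apply/subsetP => A; rewrite 2!inE => /andP[sA nA].
  have /nestedP nA' := nA.
  have inA x y : (x, y) \in A -> (x \in X) && ((y == y0) || (y \in Y)).
    by move=> /(subsetP sA); rewrite !inE.
  pose f x := fiber A x :\ y0.
  have fE x y : (y \in f x) = (y != y0) && ((x, y) \in A) by rewrite !inE.
  have chain x x' : f x \subset f x' \/ f x' \subset f x.
    have [|/subsetPn[y]] := boolP (f x \subset f x'); first by left.
    rewrite !fE => /andP[yy0 xy]; rewrite yy0 /= => nx'y; right.
    apply/subsetP => y'; rewrite !fE => /andP[-> x'y'].
    by case: (nA' _ _ _ _ xy x'y'); rewrite ?(negPf nx'y).
  have [Q0|[z zQ]] := set_0Vmem [set x | (x, y0) \in A].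
    apply/setUP; left; rewrite 2!inE nA andbT; apply/subsetP => -[x y] xyA.
    have /andP[xX /orP[/eqP ey|yY]] := inA _ _ xyA; last by rewrite inE xX.
    by move/setP/(_ x): Q0; rewrite !inE -ey xyA.
  apply/setUP; right.
  rewrite inE in zQ.
  have [x1 x1A minx1] :=
    @arg_minnP _ z (fun x => (x, y0) \in A) (fun x => #|f x|) zQ.
  pose M := [set x | ((x, y0) \in A) && (f x == f x1)].
  have x1M : x1 \in M by rewrite inE x1A /=.
  have sMX : M \subset X.
    by apply/subsetP => x; rewrite inE => /andP[/inA/andP[]].
  have Mn0 : M != set0 by apply/set0Pn; exists x1.
  apply/bigcupP; exists M; first by rewrite inE sMX.
  apply/imsetP; exists (A :&: setX (contract X M) Y).
    by rewrite inE nestedI // andbT powersetE subsetIr.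
  have [x0 pick0 x0M] : exists2 x0, [pick z in M] = Some x0 & x0 \in M.
    by case: pickP => [x0 x0M|/(_ x1)]; [exists x0 | rewrite x1M].
  have [x0A /eqP fx0] : (x0, y0) \in A /\ f x0 == f x1.
    by apply/andP; rewrite inE in x0M.
  have Y0 y : y \in Y -> y != y0 by apply: contraTneq => ->.
  have fibE x : x \in contract X M ->
      fiber (A :&: setX (contract X M) Y) x = f x.
    move=> xm; apply/setP => y; rewrite fE [LHS]inE in_setI in_setX xm /=.
    apply/andP/andP => [[-> /Y0->]//|[yy0 xy]]; split=> //.
    by have /andP[_] := inA _ _ xy; rewrite (negPf yy0).
  have x0m : x0 \in contract X M by rewrite inE (subsetP sMX) //= pick0 eqxx orbT.
  apply/setP => -[x y]; rewrite /expand pick0 [RHS]inE /=.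
  have [->|yy0] := eqVneq y y0.
    have [|xM] := boolP (x \in M); first by rewrite inE => /andP[-> _].
    have [xX|xX] := boolP (x \in X); last first.
      have -> : fiber (A :&: setX (contract X M) Y) x = set0.
        by apply/setP => y'; rewrite !inE (negPf xX) !andbF.
      by rewrite properE sub0set andbF; apply: contraNF xX => /inA/andP[].
    rewrite !fibE //; last by rewrite inE xX xM.
    (* Forwards, [x] is outside [M], so the chain and the minimality of [f x1] make the inclusion
       strict. Backwards, nestedness applied to the arcs [(x0, y0)] and [(x, y')] leaves only
       [(x, y0)]. *)
    apply/idP/idP => [xA|/properP[_ [y' y'x y'x0]]].
      have neq : f x != f x0 by apply: contraNneq xM => e; rewrite inE xA e fx0 /=.
      have lex := minx1 x; rewrite -fx0 in lex.
      rewrite properEcard; have [s|s] := chain x x0.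
        by rewrite eqEcard s (lex xA) in neq.
      by rewrite s ltnNge; apply: contra neq => le; rewrite eq_sym eqEcard s.
    move: y'x y'x0; rewrite !fE => /andP[-> xy'] /= x0y'.
    by case: (nA' _ _ _ _ x0A xy'); rewrite ?(negPf x0y').
  have [xM|xM] := boolP (x \in M).
    rewrite in_setI in_setX x0m /=.
    have /eqP : f x == f x0 by rewrite fx0; move: xM; rewrite inE => /andP[].
    move/setP/(_ y); rewrite !fE yy0 /= => ->.
    by case: (boolP (_ \in A)) => //= /inA; rewrite (negPf yy0) /= => /andP[_ ->].
  rewrite in_setI in_setX /= [_ \in contract _ _]inE xM /= andbT.
  by case: (boolP (_ \in A)) => //= /inA; rewrite (negPf yy0) /= => /andP[-> ->].
apply: leq_trans (subset_leq_card sub) _.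
apply: leq_trans (leq_card_setU _ _) _; rewrite leq_add2l.
apply: leq_trans (leq_card_bigcup _ _) _.
by apply: leq_sum => M _; apply: leq_imset_card.
Qed.

End Nested.

(** * Counting nested sets *)

Section NestedBounds.

Local Open Scope ring_scope.

Lemma sum_powerset_expr (K : comPzRingType) (T : finType) (X : {set T}) (z : K) :
  \sum_(M in powerset X) z ^+ (#|X| - #|M|) = (1 + z) ^+ #|X|.
Proof.
rewrite addrC exprDn.
rewrite (partition_big (fun M : {set T} => inord #|M| : 'I_#|X|.+1) xpredT) //=.
apply: eq_bigr => i _; rewrite expr1n mulr1.
rewrite -cards_draws -sumr_const; apply: eq_big => [M|M /andP[+ /eqP <-]].
  rewrite !inE; case: (boolP (M \subset X)) => //= /subset_leq_card le.
  by rewrite -val_eqE /= inordK.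
by rewrite inE => sMX; rewrite inordK // ltnS subset_leq_card.
Qed.

Variable R : realFieldType.

(** Induction step of the count, with [x] one less than [#|X|]: [z] is the base of the power before
    a vertex joins [Y], and [7 / 4 * z] the base after. Equality at [x = 1], [z = 2] forces the
    factor 7/4, which is twice 7/8. *)
Lemma nested_step_bound (z : R) x : 2 <= z ->
  z ^+ x + ((1 + z) ^+ x.+1 - z ^+ x.+1) <= 2 * (7 / 4 * z) ^+ x.
Proof.
move=> z2; have z0 : 0 <= z by lra.
rewrite exprMn; elim: x => [|x IHx]; first by rewrite !expr0 !expr1; lra.
have t1 : 1 <= (7 / 4 : R) ^+ x by rewrite exprn_ege1 //; lra.
have zx0 : 0 <= z ^+ x by rewrite exprn_ge0.
rewrite !exprS in IHx *.
set p := z ^+ x in zx0 IHx *; set q := (1 + z) ^+ x in IHx *.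
set t := (7 / 4) ^+ x in t1 IHx *.
have : (1 + z) * (p + ((1 + z) * q - z * p)) <= (1 + z) * (2 * (t * p)).
  by rewrite ler_wpM2l //; lra.
have : 0 <= (z - 2) * ((2 * t - 1) * p).
  by rewrite mulr_ge0 ?mulr_ge0 //; lra.
have : 0 <= (t - 1) * (z * p) by rewrite !mulr_ge0 //; lra.
lra.
Qed.

Lemma card_nested_sets_le (T1 T2 : finType) (X : {set T1}) (Y : {set T2}) :
  (0 < #|X|)%N -> (0 < #|Y|)%N ->
  #|nested_sets X Y|%:R <= (7 / 8 : R) ^+ (#|X|.-1 * #|Y|.-1) * 2 ^+ (#|X| * #|Y|).
Proof.
move=> X0 Y0.
(* The same bound, rewritten as a power with exponent [#|X|.-1]; in this form the recursion sums by
   the binomial theorem. *)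
suff le : #|nested_sets X Y|%:R <= 2 ^+ #|Y| * (2 * (7 / 4 : R) ^+ #|Y|.-1) ^+ #|X|.-1.
  apply: le_trans le _; move: X0 Y0; case: #|X| => // a; case: #|Y| => // b _ _ /=.
  rewrite exprMn -exprM mulnC (_ : 7 / 4 = 7 / 8 * 2) ?[(7 / 8 * 2) ^+ _]exprMn; last by field.
  rewrite (_ : (a.+1 * b.+1 = b.+1 + a + a * b)%N) ?exprD; last by lia.
  by rewrite le_eqVlt; apply/orP; left; apply/eqP; ring.
case eY: #|Y| Y0 => [//|y] _ /=; elim: y Y eY X X0 => [|y IHy] Y eY X X0.
  rewrite expr0 mulr1 -exprD add1n prednK // -natrX ler_nat.
  apply: leq_trans (subset_leq_card (_ : _ \subset powerset (setX X Y))) _.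
    by apply/subsetP => A; rewrite inE => /andP[].
  by rewrite card_powerset cardsX eY muln1.
have /set0Pn[y0 y0Y] : Y != set0 by rewrite -card_gt0 eY.
have eY' : #|Y :\ y0| = y.+1 by move: eY; rewrite (cardsD1 y0) y0Y => -[].
have rec := card_nested_sets_rec X (_ : y0 \notin Y :\ y0).
rewrite setD1K // -(ler_nat R) in rec; apply: le_trans (rec _) _.
  by rewrite !inE eqxx.
rewrite natrD natr_sum.
set z : R := 2 * (7 / 4) ^+ y.
have z2 : 2 <= z by rewrite /z ler_peMr // exprn_ege1 //; lra.
have IH (X' : {set T1}) : (0 < #|X'|)%N ->
    #|nested_sets X' (Y :\ y0)|%:R <= 2 ^+ y.+1 * z ^+ #|X'|.-1.
  exact: IHy.
(* Since [contract X M] has [#|X| - #|M| + 1] elements, [M] contributes [z ^+ (#|X| - #|M|)]; the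
   subtracted power is the term of the empty [M]. *)
have le1 : \sum_(M in powerset X | M != set0)
    #|nested_sets (contract X M) (Y :\ y0)|%:R <=
    2 ^+ y.+1 * ((1 + z) ^+ #|X| - z ^+ #|X|) :> R.
  rewrite -sum_powerset_expr [X in _ * (X - _)](bigD1 set0) ?inE ?sub0set //= cards0 subn0.
  rewrite addrAC subrr add0r mulr_sumr; apply: ler_sum => M.
  rewrite inE => /andP[sMX M0].
  by apply: le_trans (IH _ _) _; rewrite card_contract.
apply: le_trans (lerD (IH X X0) le1) _.
rewrite -mulrDr [2 ^+ y.+2]exprSr -[leRHS]mulrA ler_wpM2l ?exprn_ge0 //.
rewrite [(7 / 4) ^+ _]exprS mulrCA -/z -(prednK X0) /=; exact: nested_step_bound.
Qed.

End NestedBounds.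

Lemma bin2D a b : 'C(a + b, 2) = 'C(a, 2) + 'C(b, 2) + a * b.
Proof. by elim: a => [|a IHa]; rewrite ?addn0 // addSn !binS !bin1 IHa; lia. Qed.

(** * Tournaments cut into blocks along a list of classes *)

Section Classes.

Variable V : finType.
Implicit Types (C U : {set V}) (D A : {set V * V}) (s : seq {set V}).

(** Unlike in [tournament], the vertex set may be empty, so inductions can start from no vertices or
    no classes. *)
Definition tournament_on U D : bool :=
  [&& D \subset setX U U, [forall u, (u, u) \notin D]
    & [forall u in U, forall v in U,
         (u != v) ==> ((u, v) \in D) (+) ((v, u) \in D)]].

Lemma tournament_onP U D :
  reflect [/\ D \subset setX U U, forall u, (u, u) \notin D
    & {in U &, forall u v, u != v -> ((u, v) \in D) = ((v, u) \notin D)}]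
    (tournament_on U D).
Proof.
apply: (iffP and3P) => [[sD /forallP irr /forall_inP tot]|[sD irr tot]].
  split=> // u v uU vU uv.
  have := forall_inP (tot u uU) v vU; rewrite uv /= => /addbP <-.
  by rewrite negbK.
split=> //; first exact/forallP.
do 2!apply/forall_inP => ? ?; apply/implyP => uv.
by apply/addbP; rewrite (tot _ _ _ _ uv) // negbK.
Qed.

Lemma tournament_onI U C D : C \subset U -> tournament_on U D ->
  tournament_on C (D :&: setX C C).
Proof.
move=> sCU /tournament_onP[sD irr tot]; apply/tournament_onP; split.
- exact: subsetIr.
- by move=> u; rewrite inE (negPf (irr u)).
- move=> u v uC vC uv; rewrite !inE /= uC vC !andbT.
  by apply: tot => //; apply: (subsetP sCU).
Qed.

Definition triangle_free D : bool :=
  [forall u, forall v, forall w,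
    ~~ [&& (u, v) \in D, (v, w) \in D & (w, u) \in D]].

Lemma triangle_freeP D :
  reflect (forall u v w, (u, v) \in D -> (v, w) \in D -> (w, u) \notin D)
    (triangle_free D).
Proof.
apply: (iffP idP) => [/forallP tD u v w uv vw|tD].
  by move/forallP/(_ v)/forallP/(_ w): (tD u); rewrite uv vw.
do 3!apply/forallP => ?; apply/and3P => -[uv vw wu].
by move: (tD _ _ _ uv vw); rewrite wu.
Qed.

Lemma triangle_freeS D A : A \subset D -> triangle_free D -> triangle_free A.
Proof.
move=> /subsetP sAD /triangle_freeP tD; apply/triangle_freeP => u v w uv vw.
by apply/negP => /sAD; apply/negP/(tD _ _ _ (sAD _ uv) (sAD _ vw)).
Qed.

Definition transitive_tournaments C : {set {set V * V}} :=
  [set D | tournament_on C D && triangle_free D].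

(* In a triangle-free tournament in-degrees increase along arcs. *)
Lemma transitive_sink C D : C != set0 -> D \in transitive_tournaments C ->
  exists2 v, v \in C & forall w, (v, w) \notin D.
Proof.
move=> /set0Pn[z zC]; rewrite inE.
move=> /andP[/tournament_onP[sD irr tot] /triangle_freeP tD].
have [v vC vmax] :=
  @arg_maxnP _ z (fun v => v \in C) (fun v => #|[set x | (x, v) \in D]|) zC.
exists v => // w; apply/negP => vw.
have /subsetP/(_ _ vw) := sD; rewrite inE /= => /andP[_ wC].
have := vmax w wC; apply/negP; rewrite -ltnNge.
apply: proper_card; apply/properP; split; last first.
  by exists v; rewrite inE ?vw ?irr.
apply/subsetP => x; rewrite !inE => xv.
have /subsetP/(_ _ xv) := sD; rewrite inE /= => /andP[xC _].
have neq u u' : (u, u') \in D -> u != u'.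
  by apply: contraTneq => ->; exact: irr.
rewrite tot //; first exact: tD xv vw.
apply/eqP => xw; rewrite xw in xv.
by have := vw; rewrite tot ?(neq _ _ vw) // xv.
Qed.

Definition add_sink C v D : {set V * V} := D :|: setX (C :\ v) [set v].

(** A transitive tournament is determined by its sink and by the transitive tournament left after
    deleting it. *)
Lemma card_transitive_tournaments_le C : #|transitive_tournaments C| <= #|C|`!.
Proof.
move eC: #|C| => c; elim: c C eC => [|c IHc] C eC.
  rewrite (leq_trans (subset_leq_card (_ : _ \subset [set set0]))) ?cards1 //.
  apply/subsetP => D; rewrite !inE => /andP[/tournament_onP[sD _ _] _].
  by move: sD; rewrite (cards0_eq eC) -subset0 => /subset_trans; apply;
     apply/subsetP => -[u v]; rewrite !inE.
have sub : transitive_tournaments C \subset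
    \bigcup_(v in C) add_sink C v @: transitive_tournaments (C :\ v).
  apply/subsetP => D DC.
  have Cn0 : C != set0 by rewrite -card_gt0 eC.
  have [v vC vsink] := transitive_sink Cn0 DC.
  apply/bigcupP; exists v => //; move: DC.
  rewrite inE => /andP[toD tD]; have /tournament_onP[sD irr tot] := toD.
  apply/imsetP; exists (D :&: setX (C :\ v) (C :\ v)).
    rewrite inE (tournament_onI (subD1set _ _) toD) /=.
    exact: triangle_freeS (subsetIl _ _) tD.
  apply/setP => -[x y]; rewrite !inE /=.
  have [->|xv] := eqVneq x v; first by rewrite (negPf (vsink y)).
  have [->|yv] := eqVneq y v; rewrite /= ?andbF ?orbF ?andbT /=.
    have [xC|xC] := boolP (x \in C); first by rewrite tot ?vsink.
    by apply: contraNF xC => /(subsetP sD); rewrite inE => /andP[].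
  by case: (boolP (_ \in D)) => // /(subsetP sD); rewrite inE.
apply: leq_trans (subset_leq_card sub) _.
apply: leq_trans (leq_card_bigcup _ _) _.
rewrite factS -eC -sum_nat_const; apply: leq_sum => v vC.
apply: leq_trans (leq_imset_card _ _) _; apply: IHc.
by move: eC; rewrite (cardsD1 v) vC => -[].
Qed.

(** Only arcs leaving [C] are recorded: in a tournament they determine the arcs coming back. *)
Definition crossings C s : {set {set V * V}} :=
  [set A : {set V * V} | (A \subset setX C (\bigcup_(C' <- s) C'))
           && all (fun C' => nested (A :&: setX C C')) s].

Lemma card_crossings_cons C C' s :
  #|crossings C (C' :: s)| <= #|nested_sets C C'| * #|crossings C s|.
Proof.
set U := \bigcup_(C' <- s) C'.
rewrite -cardsX.
rewrite -(card_in_imset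
  (f := fun A : {set V * V} => (A :&: setX C C', A :&: setX C U))); last first.
  move=> A B; rewrite !inE big_cons -/U => /andP[sA _] /andP[sB _] [e1 e2].
  apply/setP => -[x y].
  move/setP/(_ (x, y)): e1; move/setP/(_ (x, y)): e2.
  move/subsetP/(_ (x, y)): sA; move/subsetP/(_ (x, y)): sB; rewrite !inE /=.
  case: (_ \in A); case: (_ \in B) => //=; case: (x \in C); case: (y \in C');
  by case: (y \in U) => //= a b; rewrite ?(a isT) ?(b isT).
apply: subset_leq_card; apply/subsetP => _ /imsetP[A + ->].
rewrite !inE /= => /andP[_ /andP[-> nA]]; rewrite !subsetIr /=.
apply/allP => D Ds; rewrite -setIA [_ :&: setX C D](setIidPr _).
  exact: (allP nA).
apply/subsetP => -[x y]; rewrite !inE /= => /andP[-> yD] /=.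
by rewrite /U bigcup_seq; apply/bigcupP; exists D.
Qed.

(* Disjointness of the classes is irrelevant for the upper bounds below, which
   are in terms of the sum of their sizes. *)
Definition class_tournaments s : {set {set V * V}} :=
  [set D : {set V * V} | [&& tournament_on (\bigcup_(C <- s) C) D,
               all (fun C => triangle_free (D :&: setX C C)) s
             & pairwise (fun C C' => nested (D :&: setX C C')) s]].

(** Independence of the blocks, as a product of counts: the arcs inside [U], inside [C] and from [C]
    to [U] determine [D], because an arc from [U] to [C] is present iff its reverse is absent. *)
Lemma card_class_tournaments_cons C s :
  #|class_tournaments (C :: s)| <=
  #|class_tournaments s| * #|transitive_tournaments C| * #|crossings C s|.
Proof.
set U := \bigcup_(C' <- s) C'.
rewrite -!cardsX.
rewrite -(card_in_imset (f := fun D : {set V * V} =>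
  (D :&: setX U U, D :&: setX C C, D :&: setX C U))); last first.
  move=> A B; rewrite !inE big_cons -/U.
  move=> /and3P[/tournament_onP[sA irrA totA] _ _].
  move=> /and3P[/tournament_onP[sB irrB totB] _ _] [e1 e2 e3].
  apply/setP => -[x y].
  have [->|xy] := eqVneq x y; first by rewrite (negPf (irrA y)) (negPf (irrB y)).
  have [/andP[xCU yCU]|nXY] := boolP ((x \in C :|: U) && (y \in C :|: U)); last first.
    have /negPf-> : (x, y) \notin A by apply: contra nXY => /(subsetP sA); rewrite inE.
    by apply/esym; apply: contraNF nXY => /(subsetP sB); rewrite inE.
  have inI (W1 W2 : {set V}) u v :
      A :&: setX W1 W2 = B :&: setX W1 W2 -> u \in W1 -> v \in W2 ->
      ((u, v) \in A) = ((u, v) \in B).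
    by move=> + uW vW => /setP/(_ (u, v)); rewrite !inE /= uW vW !andbT.
  move: (xCU) (yCU) => /setUP[xC|xU] /setUP[yC|yU].
  - exact: inI e2 _ _.
  - exact: inI e3 _ _.
  - by rewrite totA // totB //; congr (~~ _); apply: inI e3 _ _.
  - exact: inI e1 _ _.
apply: subset_leq_card; apply/subsetP => _ /imsetP[D + ->].
rewrite !inE /= big_cons -/U => /and3P[toD /andP[tC ts] /andP[nC ns]].
have sub C' : C' \in s -> C' \subset U.
  by move=> C's; rewrite /U bigcup_seq; apply: bigcup_sup.
have DI (W1 W2 W1' W2' : {set V}) : W1' \subset W1 -> W2' \subset W2 ->
    D :&: setX W1 W2 :&: setX W1' W2' = D :&: setX W1' W2'.
  by move=> s1 s2; rewrite -setIA [setX W1 W2 :&: _](setIidPr _) // setXS.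
rewrite !(tournament_onI _ toD) ?subsetUl ?subsetUr // tC subsetIr /=.
rewrite !andbT -andbA; apply/and3P; split.
- by apply/allP => C' C's; rewrite DI ?sub ?(allP ts).
- apply: (@sub_in_pairwise _ (mem s)) ns; last exact/allP.
  by move=> C1 C2 s1 s2; rewrite DI ?sub.
- by apply/allP => C' C's; rewrite DI ?sub ?(allP nC).
Qed.

End Classes.

(** * Powers of 7/8 for the blocks *)

Section ClassBounds.

Local Open Scope ring_scope.
Variables (R : realFieldType) (V : finType).

Lemma card_transitive_tournaments_le_pow (C : {set V}) :
  #|transitive_tournaments C|%:R <= (7 / 8 : R) ^+ 'C(#|C|.-1, 2) * 2 ^+ 'C(#|C|, 2).
Proof.
have := card_transitive_tournaments_le C; rewrite -(ler_nat R) => /le_trans; apply.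
case: #|C| => [|c]; first by rewrite !bin0n mulr1.
rewrite /=; elim: c => [|c IHc]; first by rewrite !bin_small // mulr1.
(* Going from [n.+1] to [n.+2] vertices multiplies the factorial by the left side and the claimed
   bound by the right side. *)
have step n : n.+2%:R <= (7 / 8 : R) ^+ n * 2 ^+ n.+1.
  rewrite exprS mulrCA -exprMn (_ : 7 / 8 * 2 = 7 / 4); last by field.
  elim: n => [|n IHn]; first by rewrite expr0 mulr1.
  have le1 : 1 <= (7 / 4 : R) ^+ n by rewrite exprn_ege1 //; lra.
  by rewrite exprS mulrCA -natr1; lra.
have bin2S n : 'C(n.+1, 2) = ('C(n, 2) + n)%N by rewrite binS bin1.
rewrite factS natrM (bin2S c) (bin2S c.+1) [_ ^+ (_ + c)]exprD.
rewrite [_ ^+ (_ + c.+1)]exprD mulrACA mulrC.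
by apply: ler_pM; [exact: ler0n..|exact: IHc|exact: step].
Qed.

Lemma card_crossings_le (C : {set V}) (s : seq {set V}) :
  (0 < #|C|)%N -> all (fun C' : {set V} => (0 < #|C'|)%N) s ->
  #|crossings C s|%:R <=
  (7 / 8 : R) ^+ (#|C|.-1 * \sum_(C' <- s) #|C'|.-1) *
  2 ^+ (#|C| * \sum_(C' <- s) #|C'|).
Proof.
move=> C0; elim: s => [_|C' s IHs /andP[C'0 s0]].
  rewrite !big_nil !muln0 !expr0 mulr1 lern1.
  rewrite (leq_trans (subset_leq_card (_ : _ \subset [set set0]))) ?cards1 //.
  apply/subsetP => A; rewrite !inE big_nil => /andP[sA _].
  by rewrite -subset0 (subset_trans sA) //; apply/subsetP => -[u v]; rewrite !inE andbF.
have := card_crossings_cons C C' s; rewrite -(ler_nat R) => /le_trans; apply.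
rewrite natrM !big_cons !mulnDr !exprD mulrACA.
by apply: ler_pM; rewrite ?ler0n ?IHs // card_nested_sets_le.
Qed.

(** Classes are peeled off one at a time. [bin2D] splits both exponents alike, into the first class,
    the remaining classes and a product, which is the exponent for the crossings. *)
Lemma card_class_tournaments_le (s : seq {set V}) :
  all (fun C : {set V} => (0 < #|C|)%N) s ->
  #|class_tournaments s|%:R <=
  (7 / 8 : R) ^+ 'C(\sum_(C <- s) #|C|.-1, 2) * 2 ^+ 'C(\sum_(C <- s) #|C|, 2).
Proof.
elim: s => [_|C s IHs /andP[C0 s0]].
  rewrite !big_nil !bin0n !expr0 mulr1 lern1.
  rewrite (leq_trans (subset_leq_card (_ : _ \subset [set set0]))) ?cards1 //.
  apply/subsetP => A; rewrite !inE big_nil => /andP[/tournament_onP[sA _ _] _].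
  by rewrite -subset0 (subset_trans sA) //; apply/subsetP => -[u v]; rewrite !inE.
have := card_class_tournaments_cons C s; rewrite -(ler_nat R) => /le_trans; apply.
rewrite !natrM !big_cons !bin2D !exprD mulrACA.
apply: ler_pM; rewrite ?mulr_ge0 ?ler0n //; last exact: card_crossings_le.
rewrite mulrC mulrACA; apply: ler_pM; rewrite ?ler0n ?IHs //.
exact: card_transitive_tournaments_le_pow.
Qed.

End ClassBounds.

(** * From acyclicity to the absence of directed triangles and 4-cycles *)

Section Dicolourings.

Variable V : finType.
Implicit Types (D : {set V * V}) (P : {set {set V}}).

Lemma tournamentP D : tournament D -> tournament_on [set: V] D.
Proof.
case/and3P => _ /forallP irr /forallP tot.
apply/and3P; split; last 1 first.
- by apply/forall_inP => u _; apply/forall_inP => v _; move/forallP: (tot u).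
- by apply/subsetP => -[u v]; rewrite !inE.
- exact/forallP.
Qed.

Lemma acyclic_triangle_free D : acyclic D -> triangle_free D.
Proof.
move/acyclicP => acD; apply/triangle_freeP => u v w uv vw; apply/negP => wu.
have irr x : (x, x) \notin D.
  by apply/negP => xx; have := acD [:: x]; rewrite /ucycle /Defs.arc /= xx => /(_ isT).
have neq a b : (a, b) \in D -> a != b by apply: contraTneq => ->; exact: irr.
have := acD [:: u; v; w]; rewrite /ucycle /Defs.arc /= !inE uv vw wu.
by rewrite [u == w]eq_sym !(negPf (neq _ _ _)) // => /(_ isT).
Qed.

(** If nestedness fails, the two missing arcs are present reversed and close the cycle [x], [y],
    [x'], [y']. Its vertices are distinct, as otherwise [D] would contain opposite arcs. *)
Lemma acyclic_between_nested D (X Y : {set V}) : tournament D -> [disjoint X & Y] ->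
  acyclic (between D X Y) -> nested (D :&: setX X Y).
Proof.
move=> /tournamentP/tournament_onP[_ _ tot] /pred0P dXY /acyclicP acD.
have neq x y : x \in X -> y \in Y -> x != y.
  by move=> xX; apply: contraTneq => <-; have := dXY x; rewrite /= xX /= => ->.
apply/nestedP => x x' y y'; rewrite !inE /=.
move=> /andP[xy /andP[xX yY]] /andP[x'y' /andP[x'X y'Y]].
rewrite xX yY x'X y'Y !andbT; apply/orP.
rewrite [(x, y') \in D]tot ?inE ?neq // [(x', y) \in D]tot ?inE ?neq // -negb_and.
apply/negP => /andP[y'x yx'].
have nxx' : x != x'.
  by apply: contraTneq yx' => <-; rewrite -tot ?inE ?neq.
have nyy' : y != y'.
  by apply: contraTneq yx' => ->; rewrite -tot ?inE ?neq.
have := acD [:: x; y; x'; y']; rewrite /ucycle /= /Defs.arc /= !inE /=.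
rewrite xy yx' x'y' y'x xX x'X yY y'Y /= !orbT (negPf nxx') (negPf nyy').
rewrite [y == x']eq_sym !(negPf (neq _ _ _ _)) //=.
by move/(_ isT).
Qed.

Lemma dicolouring_class_tournaments D P :
  tournament D -> acyclic_dicolouring D P -> D \in class_tournaments (enum P).
Proof.
move=> tD /and3P[/and3P[/eqP covP /trivIsetP triP _] /forall_inP acC /forall_inP acXY].
rewrite inE; apply/and3P; split.
- rewrite big_enum; have -> : \bigcup_(C in P) C = [set: V] by [].
  exact: tournamentP.
- by apply/allP => C; rewrite mem_enum => /acC/acyclic_triangle_free.
- have := enum_uniq P; rewrite uniq_pairwise.
  apply: (@sub_in_pairwise _ (mem P)); last by apply/allP => C; rewrite mem_enum.
  move=> X Y XP YP /= nXY; apply: acyclic_between_nested => //; first exact: triP.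
  by have := forall_inP (acXY X XP) Y YP; rewrite nXY.
Qed.

End Dicolourings.

(** * Union bound over the partitions *)

Lemma card_ltn_pairs n : #|[set p : 'I_n * 'I_n | p.1 < p.2]| = 'C(n, 2).
Proof.
rewrite -sum1dep_card -(pair_big_dep xpredT (fun i j : 'I_n => i < j) (fun _ _ => 1)) /=.
rewrite (exchange_big_dep xpredT) //= -bin2_sum big_mkord; apply: eq_bigr => j _.
by rewrite -(big_ord_widen n (fun=> 1)) ?sum1_card ?card_ord // ltnW.
Qed.

(** Each set [S] of pairs [u < v] gives a tournament: edges in [S] point upwards, the others
    downwards. *)
Lemma card_tournaments_ge n : 0 < n -> 2 ^ 'C(n, 2) <= #|tournaments n|.
Proof.
move=> n0; rewrite -card_ltn_pairs -card_powerset.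
set E := [set p | _].
pose f (S : {set 'I_n * 'I_n}) := S :|: [set p | (p.2, p.1) \in E :\: S].
rewrite -(card_in_imset (f := f)); last first.
  have fI (S : {set 'I_n * 'I_n}) : S \subset E -> f S :&: E = S.
    move=> /subsetP sSE; apply/setP => -[u v]; rewrite !inE /=.
    have := sSE (u, v); rewrite !inE /=.
    by case: (_ \in S) => [->//|_] /=; case: ltngtP; rewrite ?andbF.
  by move=> S S'; rewrite !inE => sS sS' e; rewrite -(fI S) // e fI.
apply: subset_leq_card; apply/subsetP => _ /imsetP[S + ->]; rewrite !inE => /subsetP sSE.
have SE u v : (u, v) \in S -> u < v by move=> /sSE; rewrite inE.
apply/and3P; split; first by rewrite card_ord.
  by apply/forallP => u; rewrite !inE /= ltnn andbF orbF; apply/negP => /SE; rewrite ltnn.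
apply/forallP => u; apply/forallP => v; apply/implyP => uv; rewrite !inE /=.
have := SE u v; have := SE v u.
case: (_ \in S); case: (_ \in S) => //=; case: ltngtP => //=.
- by move=> _ _ /(_ isT).
- by move=> _ /(_ isT).
- by move=> _ /(_ isT).
- by move/val_inj => e; rewrite e eqxx in uv.
Qed.

(** All classes are nonempty, so their sizes less one add up to the defect [n - #|P|]. *)
Lemma card_dicoloured_tournaments_le (R : realFieldType) n (P : {set {set 'I_n}}) :
  0 < n -> partition P [set: 'I_n] ->
  (#|[set D in tournaments n | acyclic_dicolouring D P]|%:R <=
   (7 / 8 : R) ^+ 'C(n - #|P|, 2) * #|tournaments n|%:R)%R.
Proof.
move=> n0 partP; have /and3P[_ _ P0] := partP.
have nonempty : all (fun C : {set 'I_n} => 0 < #|C|) (enum P).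
  apply/allP => C; rewrite mem_enum card_gt0; apply: contraTneq => ->.
  by rewrite (negPf P0).
have sumP : \sum_(C <- enum P) #|C| = n.
  by rewrite big_enum -(card_partition partP) cardsT card_ord.
have sumP1 : \sum_(C <- enum P) #|C|.-1 = n - #|P|.
  transitivity (\sum_(C <- enum P) #|C| - #|P|); last by rewrite sumP.
  rewrite !big_enum -sum1_card -sumnB /=.
    by apply: eq_bigr => C _; rewrite subn1.
  by move=> C CP; rewrite (allP nonempty) ?mem_enum.
apply: (@le_trans _ _ (#|class_tournaments (enum P)|%:R)%R).
  rewrite ler_nat; apply: subset_leq_card; apply/subsetP => D.
  by rewrite inE => /andP[]; rewrite inE; apply: dicolouring_class_tournaments.
apply: le_trans (card_class_tournaments_le _ nonempty) _.
rewrite sumP sumP1 ler_wpM2l ?exprn_ge0 ?divr_ge0 // -natrX ler_nat.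
exact: card_tournaments_ge.
Qed.

(** The defect counts the vertices that do not represent their class; paired with their
    representatives, they form a [k]-subset of [T * T] that encodes [P]. The vertex [x0] is the
    default of [transversal_repr]. *)
Lemma card_partitions_le (T : finType) (x0 : T) k :
  #|[set P : {set {set T}} | partition P [set: T] && (#|T| - #|P| == k)]| <=
  'C(#|T| ^ 2, k).
Proof.
pose rep (P : {set {set T}}) x := transversal_repr x0 (transversal P setT) (pblock P x).
have block_mem (P : {set {set T}}) x : partition P [set: T] -> pblock P x \in P.
  by case/and3P => /eqP covP _ _; rewrite pblock_mem // covP.
have rep_pblock P x y : partition P [set: T] -> (rep P x == rep P y) = (y \in pblock P x).
  move=> pP; have /and3P[/eqP covP triP _] := pP.
  rewrite -eq_pblock ?covP //; apply/eqP/eqP => [e|e]; last by rewrite /rep e.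
  have repK z : pblock P (rep P z) = pblock P z.
    by rewrite /rep (transversal_reprK (transversalP pP)) ?block_mem.
  by rewrite -repK e repK.
have card_rep P : partition P [set: T] -> #|[set x | rep P x == x]| = #|P|.
  move=> pP; have trX := transversalP pP.
  rewrite -(card_transversal trX); apply: eq_card => x; rewrite inE.
  apply/eqP/idP => [<-|xX]; first by rewrite (repr_mem_transversal trX) ?block_mem.
  by rewrite /rep (pblockK trX).
pose f P := [set p | (rep P p.2 == p.1) && (p.2 != p.1)].
rewrite -mulnn -card_prod -card_draws.
rewrite -(card_in_imset (f := f)); last first.
  move=> P Q; rewrite !inE => /andP[pP _] /andP[pQ _] /setP eqf.
  (* A vertex that is the second component of no pair in [f P] is its own representative; any other
     is paired with its representative. *)
  have eqrep x : rep P x = rep Q x.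
    have := eqf (rep P x, x); have := eqf (rep Q x, x).
    rewrite !inE /= !eqxx /=.
    have [<-|_] := eqVneq x (rep Q x); last by rewrite andbT => /eqP.
    by move=> _; case: eqVneq => [<-//|_]; rewrite andbT => /esym/eqP.
  have sub (P1 P2 : {set {set T}}) : partition P1 [set: T] -> partition P2 [set: T] ->
      (forall x, rep P1 x = rep P2 x) -> P1 \subset P2.
    move=> p1 p2 e; apply/subsetP => A AP1; have /and3P[_ triP1 nP1] := p1.
    have /set0Pn[x xA] : A != set0 by apply: contraNneq nP1 => <-.
    have -> : A = pblock P2 x; last exact: block_mem.
    rewrite -(def_pblock triP1 AP1 xA); apply/setP => y.
    by rewrite -!rep_pblock // !e.
  by apply/eqP; rewrite eqEsubset !sub.
apply: subset_leq_card; apply/subsetP => _ /imsetP[P + ->].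
rewrite !inE => /andP[pP /eqP <-]; rewrite -(card_rep P pP).
rewrite -(cardsC [set x | rep P x == x]) addKn.
have -> : f P = (fun x => (rep P x, x)) @: ~: [set x | rep P x == x].
  apply/setP => -[x y]; rewrite !inE /=; apply/andP/imsetP => [[/eqP <- yx]|[z]].
    by exists y => //; rewrite !inE eq_sym.
  by rewrite !inE => zz [-> ->]; rewrite eqxx eq_sym.
by rewrite card_imset // => x y [].
Qed.

Lemma ffact_leq_exp n k : n ^_ k <= n ^ k.
Proof.
by elim: k => [//|k IHk]; rewrite ffactnSr expnSr leq_mul ?leq_subr.
Qed.

Local Open Scope ring_scope.

(** An optimal dicolouring is a partition whose defect satisfies [Q]; the union bound over such
    partitions is grouped by defect. Taking a predicate allows a real threshold without rounding. *)
Lemma card_tournaments_dichromatic_le (R : realFieldType) n (Q : pred nat) : (0 < n)%N ->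
  #|[set D in tournaments n | Q (n - acyclic_dichromatic_number D)%N]|%:R <=
  (\sum_(k < n.+1 | Q k) 'C(n ^ 2, k)%:R * (7 / 8 : R) ^+ 'C(k, 2)) *
  #|tournaments n|%:R.
Proof.
move=> n0.
have sub : [set D in tournaments n | Q (n - acyclic_dichromatic_number D)%N] \subset
    \bigcup_(P : {set {set 'I_n}} | partition P [set: 'I_n] && Q (n - #|P|)%N)
      [set D in tournaments n | acyclic_dicolouring D P].
  apply/subsetP => D; rewrite inE => /andP[Dn QD].
  have tD : tournament D by rewrite inE in Dn.
  have [[P dP eP] _] := acyclic_dichromatic_numberP (tournament_oriented tD).
  apply/bigcupP; exists P; last by rewrite inE Dn.
  by have /and3P[-> _ _] := dP; rewrite eP.
have := leq_trans (subset_leq_card sub) (leq_card_bigcup _ _).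
rewrite -(ler_nat R) => /le_trans; apply.
rewrite natr_sum mulr_suml.
rewrite (partition_big (fun P : {set {set 'I_n}} => inord (n - #|P|) : 'I_n.+1)
  (fun k : 'I_n.+1 => Q k)) /=; last first.
  by move=> P /andP[_ QP]; rewrite inordK // ltnS leq_subr.
apply: ler_sum => k Qk; rewrite -mulrA.
have eqk (P : {set {set 'I_n}}) : (inord (n - #|P|) == k :> 'I_n.+1) = (n - #|P| == k)%N.
  by rewrite -val_eqE /= inordK // ltnS leq_subr.
have := card_partitions_le (Ordinal n0) k; rewrite card_ord -(ler_nat R) => le1.
apply: (@le_trans _ _ (\sum_(P in [set P : {set {set 'I_n}} |
    partition P [set: 'I_n] && (n - #|P| == k)%N])
      (7 / 8 : R) ^+ 'C(k, 2) * #|tournaments n|%:R)).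
  under eq_bigl => P do rewrite eqk.
  under [leRHS]eq_bigl => P do rewrite inE.
  rewrite [leRHS](bigID (fun P : {set {set 'I_n}} => Q (n - #|P|)%N)) /=.
  rewrite (eq_bigl (fun P : {set {set 'I_n}} =>
    partition P [set: 'I_n] && (n - #|P| == k)%N && Q (n - #|P|)%N)); last first.
    by move=> P; rewrite andbAC.
  rewrite ler_wpDr ?sumr_ge0 // => [P _|]; first by rewrite mulr_ge0 ?exprn_ge0 ?divr_ge0.
  apply: ler_sum => P /andP[/andP[pP /eqP <-] _].
  exact: card_dicoloured_tournaments_le.
rewrite sumr_const -[_ *+ #|_|]mulr_natl ler_wpM2r // mulr_ge0 ?exprn_ge0 ?divr_ge0 //.
Qed.


Lemma Pr_tournament_le1 (R : realType) n (A : pred {set 'I_n * 'I_n}) : (0 < n)%N ->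
  Pr_tournament R A <= 1.
Proof.
move=> n0; rewrite /Pr_tournament ler_pdivrMr ?ltr0n ?tournaments_gt0 // mul1r.
by rewrite ler_nat subset_leq_card //; apply/subsetP => D; rewrite inE => /andP[].
Qed.

Lemma Pr_tournament_ge (R : realType) n (A : pred {set 'I_n * 'I_n}) (Q : pred nat) :
  (0 < n)%N -> (forall D, ~~ A D -> Q (n - acyclic_dichromatic_number D)%N) ->
  1 - \sum_(k < n.+1 | Q k) 'C(n ^ 2, k)%:R * (7 / 8 : R) ^+ 'C(k, 2) <=
  Pr_tournament R A.
Proof.
move=> n0 AQ; have T0 : (0 : R) < #|tournaments n|%:R by rewrite ltr0n tournaments_gt0.
rewrite /Pr_tournament ler_pdivlMr // mulrBl mul1r lerBlDr.
apply: le_trans (lerD (lexx _) (card_tournaments_dichromatic_le R Q n0)).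
rewrite -natrD ler_nat -(cardsID [set D | A D] (tournaments n)).
apply: leq_add; apply: subset_leq_card; apply/subsetP => D; rewrite !inE //.
by move=> /andP[nA ->]; rewrite AQ.
Qed.

From mathcomp Require Import all_classical all_reals all_analysis.

Import numFieldNormedType.Exports.

Local Open Scope classical_set_scope.
Local Open Scope ring_scope.

(** * Estimates for the terms of the union bound *)

Section Asymptotics.

Variable R : realType.

(** This is C(n, k) <= (e n / k)^k; it follows from k^k / k! <= e^k, one term of the exponential
    series. *)
Lemma bin_le_expR n k : (0 < n)%N -> (0 < k)%N ->
  'C(n, k)%:R <= expR (k%:R * (ln n%:R - ln k%:R + 1)) :> R.
Proof.
move=> n0 k0; have n0' : (0 : R) < n%:R by rewrite ltr0n.
have k0' : (0 : R) < k%:R by rewrite ltr0n.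
rewrite expRM_natl expRD expRB !lnK ?posrE // exprMn expr_div_n mulrAC.
rewrite ler_pdivlMr ?exprn_gt0 //.
have le1 : k%:R ^+ k <= k`!%:R * expR 1 ^+ k :> R.
  have := @expR_ge1Dxn R k%:R k.-1 (ltW k0'); rewrite prednK // => le.
  rewrite -expRM_natl mulr1 mulrC -ler_pdivrMr ?ltr0n ?fact_gt0 //.
  by apply: le_trans le; rewrite lerDr.
apply: (le_trans (ler_wpM2l _ le1)); rewrite ?ler0n // mulrA.
rewrite ler_wpM2r ?exprn_ge0 ?expR_ge0 //.
rewrite -natrM -natrX ler_nat bin_ffact.
exact: ffact_leq_exp.
Qed.

(** Follows from ln y <= y - 1 at y = x ln 2, with 1/2 <= ln 2 <= 1. At [x = log2 n] it keeps the
    iterated logarithm in the threshold below [log2 n]. *)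
Lemma log2_le (x : R) : 0 < x -> log2 x <= x.
Proof.
move=> x0; have ln2 : 2^-1 <= ln 2 :> R.
  have := @le_ln1Dx R (- 2^-1); rewrite (_ : 1 - 2^-1 = 2^-1); last by field.
  rewrite lnV ?posrE // => /(_ _); rewrite lerN2; apply; lra.
have l0 : 0 < ln 2 :> R by lra.
rewrite /log2 ler_pdivrMr //.
have := @le_ln1Dx R (x * ln 2 - 1).
rewrite addrCA subrr addr0 lnM ?posrE // => /(_ _) le1.
have lnln2 : - ln 2 <= ln (ln 2) :> R by rewrite -lnV ?posrE // ler_ln ?posrE.
have := @le_ln1Dx R 1; rewrite -[1 + 1]/(2%:R) => /(_ _) ln21.
have : 0 < x * ln 2 by rewrite mulr_gt0.
lra.
Qed.

(* The constant term makes the bracket in the exponent of [union_bound_term]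
   equal to - ln 2 at the threshold, after replacing ln k by ln (log2 n). *)
Definition defect_threshold (n : nat) : R :=
  let r : R := log2 (8 / 7) in
  4 / r * log2 n%:R - 2 / r * log2 (log2 n%:R) + (1 + 2 * (1 + ln 2) / ln (8 / 7)).

(** The logarithm of the left side is at most [k] times a bracket, which the threshold pushes below
    - ln 2; then [k >= 2 * log2 n] turns - k ln 2 into at most - 2 ln n. *)
Lemma union_bound_term n k : (1 < n)%N -> defect_threshold n < k%:R ->
  'C(n ^ 2, k)%:R * (7 / 8 : R) ^+ 'C(k, 2) <= (n%:R ^+ 2)^-1.
Proof.
move=> n1 kn; have n0 : (0 < n)%N by apply: ltnW.
have n0' : (0 : R) < n%:R by rewrite ltr0n.
have ln2 : 0 < ln 2 :> R by rewrite ln_gt0 // ltr1n.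
have lnn : ln 2 <= ln n%:R :> R by rewrite ler_ln ?posrE // ler_nat.
set rho : R := ln (8 / 7).
have rho0 : 0 < rho by rewrite ln_gt0 //; lra.
have rho1 : rho <= ln 2 by rewrite ler_ln ?posrE //; lra.
set L : R := log2 n%:R.
have L0 : 0 < L by rewrite divr_gt0 //; lra.
have lnE : ln n%:R = L * ln 2 :> R by rewrite /L /log2 divfK ?gt_eqF.
have LL := log2_le L0.
have lnLE : ln L = log2 L * ln 2 :> R by rewrite /log2 divfK ?gt_eqF.
have rE : log2 (8 / 7) = rho / ln 2 :> R by [].
have defE : rho * defect_threshold n =
    4 * ln n%:R - 2 * ln L + (rho + 2 * (1 + ln 2)).
  rewrite /defect_threshold rE -/L -/rho lnE lnLE; field.
  by rewrite !gt_eqF.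
have rk : rho * defect_threshold n < rho * k%:R by rewrite ltr_pM2l.
(* From [rho <= ln 2] and [log2 L <= L]: the main term 4 L ln 2 of [rho * defect_threshold n] loses
   at most 2 L ln 2. *)
have kL : 2 * L <= k%:R.
  have : ln 2 * (2 * L) <= ln 2 * k%:R.
    have : rho * k%:R <= ln 2 * k%:R by rewrite ler_wpM2r.
    have : log2 L * ln 2 <= L * ln 2 by rewrite ler_wpM2r // ltW.
    lra.
  by rewrite ler_pM2l.
have k0 : (0 < k)%N by rewrite -(ltr0n R); lra.
have k0' : 0 < k%:R :> R by rewrite ltr0n.
have lnk : ln L <= ln k%:R by rewrite ler_ln ?posrE //; lra.
have q0 : 0 <= (7 / 8 : R) ^+ 'C(k, 2) by rewrite exprn_ge0 ?divr_ge0.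
have N0 : (0 < n ^ 2)%N by rewrite expn_gt0 n0.
apply: le_trans (ler_wpM2r q0 (bin_le_expR N0 k0)) _.
have -> : (7 / 8 : R) = expR (- rho).
  by rewrite expRN lnK ?posrE ?invf_div //; lra.
rewrite -expRM_natl -expRD natrX lnXn //.
have -> : (n%:R ^+ 2)^-1 = expR (- (2 * ln n%:R)) :> R.
  by rewrite expRN -[2]/(2%:R) expRM_natl lnK.
have -> : 'C(k, 2)%:R = k%:R * (k%:R - 1) / 2 :> R.
  have := bin_ffact k 2; rewrite ffactnS ffactn1 -subn1 => /(congr1 (fun m => m%:R : R)).
  by rewrite !natrM natrB // => <-; field.
rewrite ler_expR.
have -> : k%:R * (ln n%:R *+ 2 - ln k%:R + 1) + k%:R * (k%:R - 1) / 2 * - rho =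
  k%:R * (2 * ln n%:R - ln k%:R + 1 - (k%:R - 1) / 2 * rho) by rewrite -mulr_natl; field.
apply: (@le_trans _ _ (k%:R * (- ln 2))); first by rewrite ler_wpM2l //; lra.
have : 2 * L * ln 2 <= k%:R * ln 2 by rewrite ler_wpM2r // ltW.
lra.
Qed.

End Asymptotics.

(** * Convergence of the probability to 1 *)

Theorem theorem1p2 (R : realType) :
  let r : R := log2 (8 / 7) in
  let a : R := 4 / r in
  let beta : R := 2 / r in
  exists C : R,
    (fun n : nat =>
       Pr_tournament R (fun D : {set 'I_n * 'I_n} =>
         n%:R - a * log2 (n%:R : R) + beta * log2 (log2 (n%:R : R)) - C
           <= (acyclic_dichromatic_number D)%:R))
      @ \oo --> (1 : R).
Proof.
move=> r a beta; exists (1 + 2 * (1 + ln 2) / ln (8 / 7)).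
(* There are at most n + 1 terms of size n^-2, and (n + 1) / n^2 <= 4 / (n + 1) because n + 1 <= 2
   n; [harmonic n] is 1 / (n + 1). *)
apply: (@squeeze_cvgr _ _ _ _ (fun n => 1 - 4 * harmonic n) (fun=> 1)); last 2 first.
- rewrite -[X in _ --> X]subr0 -[X in _ - X](mulr0 4).
  by apply: cvgB; [exact: cvg_cst | apply: cvgMr; exact: cvg_harmonic].
- exact: cvg_cst.
exists 2 => // n /= n1; have n0 : (0 < n)%N by apply: ltnW.
apply/andP; split; last exact: Pr_tournament_le1.
set A := (X in Pr_tournament R X).
have AQ D : ~~ A D -> defect_threshold R n < (n - acyclic_dichromatic_number D)%:R.
  rewrite /A -ltNge /defect_threshold -/r -/a -/beta => lt.
  (* Truncated subtraction is at least the real difference, which is the direction required. *)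
  have nD : n%:R <= (n - acyclic_dichromatic_number D)%:R +
      (acyclic_dichromatic_number D)%:R :> R.
    by rewrite -natrD ler_nat addnC -leq_subLR.
  by lra.
apply: le_trans (Pr_tournament_ge R (Q := fun k => defect_threshold R n < k%:R) n0 AQ).
rewrite lerD2l lerN2.
have n0' : (0 : R) < n%:R by rewrite ltr0n.
apply: (@le_trans _ _ (\sum_(k < n.+1) (n%:R ^+ 2)^-1)).
  rewrite [leRHS](bigID (fun k : 'I_n.+1 => defect_threshold R n < k%:R)) /=.
  apply: ler_wpDr; first by apply: sumr_ge0 => k _; rewrite invr_ge0 sqr_ge0.
  by apply: ler_sum => k; apply: union_bound_term.
rewrite sumr_const card_ord -[_ *+ n.+1]mulr_natl /harmonic /= ler_pdivrMr ?exprn_gt0 //.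
rewrite mulrAC ler_pdivlMr ?ltr0n // -natr1.
have : (1 : R) <= n%:R by rewrite ler1n.
nra.
Qed.
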